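(* Let $d\ge2$ and let $q^{\mathrm{pu}}$ be the $\varepsilon$-LDP $\texttt{PrivUnit}_2$ mechanism on $\mathbb{S}^{d-1}$ with parameters $p_0$ and $\gamma$ and estimator $\hat{\mathbf{x}}^{\mathrm{pu}}=\mathbf{z}/m_{\mathrm{pu}}$. Let $q^{\mathrm{mmrc}}$ denote the MMRC mechanism simulating $\texttt{PrivUnit}_2$ with $N$ candidates and estimator $\hat{\mathbf{x}}^{\mathrm{mmrc}}=\mathbf{z}_K/m_{\mathrm{mmrc}}$. Let $\lambda>0$. If \[ N\ge\frac{e^{2\varepsilon}}{2}\Big(\frac{2(1+\lambda)}{\lambda(p_0-1/2)}\Big)^2\ln\Big(\frac{4(1+\lambda)}{\lambda(p_0-1/2)}\Big), \] then for every $\mathbf{x}\in\mathbb{S}^{d-1}$, \[ \mathbb{E}_{q^{\mathrm{mmrc}}}\big[\|\hat{\mathbf{x}}^{\mathrm{mmrc}}-\mathbf{x}\|_2^2\big]\le(1+\lambda)^2E+2(1+\lambda)(2+\lambda)\sqrt{E}+(2+\lambda)^2,\qquad E=\mathbb{E}_{q^{\mathrm{pu}}}\big[\|\hat{\mathbf{x}}^{\mathrm{pu}}-\mathbf{x}\|_2^2\big]. \]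
   Context: $\texttt{PrivUnit}_2$ with parameters $\gamma\in[0,1]$, $p_0\ge1/2$ (chosen so the mechanism is $\varepsilon$-LDP, i.e. its output density ratio between any two inputs is at most $e^\varepsilon$): on input $\mathbf{x}\in\mathbb{S}^{d-1}$, output $\mathbf{z}$ uniform on $\mathsf{Cap}_{\mathbf{x}}=\{\mathbf{z}\in\mathbb{S}^{d-1}:\langle\mathbf{z},\mathbf{x}\rangle\ge\gamma\}$ with probability $p_0$ and uniform on its complement otherwise. Its density w.r.t. the uniform probability on the sphere is $c_1=p_0/\bar\theta$ on the cap and $c_2=(1-p_0)/(1-\bar\theta)$ off it, where $\bar\theta=\mathbb{P}_{\mathbf{z}\sim\mathrm{Unif}(\mathbb{S}^{d-1})}(\mathbf{z}\in\mathsf{Cap}_{\mathbf{x}})$. For $p\in[0,1]$ let $m(p)=\frac{(1-\gamma^2)^{\alpha}}{2^{d-2}(d-1)}\big[\frac{p}{B(\alpha,\alpha)-B(\tau;\alpha,\alpha)}-\frac{1-p}{B(\tau;\alpha,\alpha)}\big]$, $\alpha=\frac{d-1}2$, $\tau=\frac{1+\gamma}2$, $B(x;a,b)=\int_0^xt^{a-1}(1-t)^{b-1}dt$, $B(a,b)=B(1;a,b)$; $m_{\mathrm{pu}}=m(p_0)$. MMRC simulating $\texttt{PrivUnit}_2$: draw $\mathbf{z}_1,\dots,\mathbf{z}_N$ i.i.d. uniform on $\mathbb{S}^{d-1}$; $\theta=\frac1N\#\{k:\mathbf{z}_k\in\mathsf{Cap}_{\mathbf{x}}\}$; $\pi^{\mathrm{mrc}}(k)=\frac1N\frac{c_i}{\theta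 c_1+(1-\theta)c_2}$ ($i=1$ for cap candidates, $i=2$ otherwise); $t_u=\frac1N\frac{c_1}{\bar\theta c_1+(1-\bar\theta)c_2}$, $t_l=\frac1N\frac{c_2}{\bar\theta c_1+(1-\bar\theta)c_2}$; $\pi^{\mathrm{mmrc}}=\pi^{\mathrm{mrc}}$ if $\theta=\bar\theta$; if $\theta<\bar\theta$, $\pi^{\mathrm{mmrc}}(k)=t_u$ on cap candidates and $\frac{1-N\theta t_u}{N(1-\theta)}$ otherwise; if $\theta>\bar\theta$, $\pi^{\mathrm{mmrc}}(k)=t_l$ on non-cap candidates and $\frac{1-N(1-\theta)t_l}{N\theta}$ otherwise. $K\sim\pi^{\mathrm{mmrc}}$, $p_{\mathrm{mmrc}}=\mathbb{P}(\mathbf{z}_K\in\mathsf{Cap}_{\mathbf{x}})$ and $m_{\mathrm{mmrc}}=m(p_{\mathrm{mmrc}})$. $\mathbb{E}_{q^{\mathrm{mmrc}}}$ is over the candidates and $K$. *)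

(* Defs.v *)
From HB Require Import structures.
From mathcomp Require Import all_boot all_order all_algebra.
From mathcomp Require Import all_classical all_reals all_analysis.
Set Implicit Arguments. Unset Strict Implicit. Unset Printing Implicit Defensive.
Import Order.TTheory GRing.Theory Num.Theory.
Import numFieldNormedType.Exports.
Local Open Scope classical_set_scope.
Local Open Scope ring_scope.

Section Defs.
Context {R : realType}.

Definition dotv {d : nat} (u v : 'rV[R]_d) : R := \sum_(i < d) u 0 i * v 0 i.
Definition sqnorm {d : nat} (u : 'rV[R]_d) : R := dotv u u.
Definition Ssphere (d : nat) : set 'rV[R]_d := [set z | sqnorm z = 1].
Definition Cap {d : nat} (gamma : R) (x : 'rV[R]_d) : set 'rV[R]_d :=
  [set z | gamma <= dotv z x].

Definition borelRd (d : nat) : set (set 'rV[R]_d) := <<s open >>.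

Context {dO : measure_display} {Omega : measurableType dO}.

Definition Prob (P : probability Omega R) (A : set Omega) : R := fine (P A).

Definition rv_measurable {d : nat} (Z : Omega -> 'rV[R]_d) :=
  forall A, borelRd A -> measurable (Z @^-1` A).

(* Z is uniformly distributed on the sphere: its law is the (unique)
   rotation-invariant probability on R^d carried by the sphere. *)
Definition unif_sphere {d : nat} (P : probability Omega R) (Z : Omega -> 'rV[R]_d) :=
  [/\ rv_measurable Z,
      P (Z @^-1` @Ssphere d) = 1%E &
      forall Q : 'M[R]_d, Q *m Q^T = 1%:M ->
        forall A, borelRd A -> P (Z @^-1` A) = P ((fun w => Z w *m Q) @^-1` A)].

Definition mutually_indep {d N : nat} (P : probability Omega R)
  (Z : 'I_N -> Omega -> 'rV[R]_d) :=
  forall A : 'I_N -> set 'rV[R]_d, (forall k, borelRd (A k)) ->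
    Prob P [set w | forall k, A k (Z k w)] = \prod_(k < N) Prob P (Z k @^-1` A k).

Definition thetabar {d : nat} (P : probability Omega R) (U : Omega -> 'rV[R]_d)
  (gamma : R) (x : 'rV[R]_d) : R := Prob P (U @^-1` Cap gamma x).

End Defs.

Section Defs2.
Context {R : realType}.

Definition betainc (a b x : R) : R :=
  fine (\int[@lebesgue_measure R]_(t in [set t : R | 0 <= t <= x])
          ((t `^ (a - 1)) * ((1 - t) `^ (b - 1)))%:E).
Definition betaf (a b : R) : R := betainc a b 1.

Definition mPU (d : nat) (gamma p : R) : R :=
  let alpha := (d%:R - 1) / 2 in
  let tau := (1 + gamma) / 2 in
  (1 - gamma ^+ 2) `^ alpha / (2 ^+ (d - 2) * (d%:R - 1)) *
  (p / (betaf alpha alpha - betainc alpha alpha tau) - (1 - p) / betainc alpha alpha tau).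

(* PrivUnit2 constants and density w.r.t. the uniform probability *)
Definition c1 (p0 thb : R) : R := p0 / thb.
Definition c2 (p0 thb : R) : R := (1 - p0) / (1 - thb).
Definition pu_density {d : nat} (gamma p0 thb : R) (x z : 'rV[R]_d) : R :=
  if gamma <= dotv z x then c1 p0 thb else c2 p0 thb.

Definition pi_mmrc {d N : nat} (gamma p0 thb : R) (x : 'rV[R]_d)
  (zs : 'I_N -> 'rV[R]_d) (k : 'I_N) : R :=
  let inc := fun j => gamma <= dotv (zs j) x in
  let a := c1 p0 thb in
  let b := c2 p0 thb in
  let Nr : R := N%:R in
  let theta := (\sum_(j < N) (if inc j then 1 else 0 : R)) / Nr in
  let tu := (1 / Nr) * (a / (thb * a + (1 - thb) * b)) in
  let tl := (1 / Nr) * (b / (thb * a + (1 - thb) * b)) in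
  if theta == thb then
    (1 / Nr) * ((if inc k then a else b) / (theta * a + (1 - theta) * b))
  else if theta < thb then
    (if inc k then tu else (1 - Nr * theta * tu) / (Nr * (1 - theta)))
  else
    (if inc k then (1 - Nr * (1 - theta) * tl) / (Nr * theta) else tl).

End Defs2.

(* Main.v *)
(** Write [D = lambda (p0 - 1/2) / (1 + lambda)]. Since all outputs lie on the
    unit sphere, the MMRC risk is at most [(1/m_mmrc + 1)^2], while the risk [E]
    of PrivUnit2 is at least [(1/m_pu - 1)^2]; so it suffices to show
    [m_pu <= (1 + lambda) m_mmrc]. As [m] is affine and vanishes at a point
    [q <= 1/2] (symmetry of the beta integral), this follows from
    [p_mmrc >= p0 - D].
    Given the candidates, the cap probability drops below [p0] only when caps are
    under-represented, and then by [c1 (thb - theta)]. The variance of the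
    empirical frequency [theta] is [thb (1 - thb) / N], and [c1 <= e^eps] by local
    privacy, so the sample size makes the expected loss at most [D]: a second
    moment bound replaces the usual concentration inequality.
    The candidates and the reference point hit a cap with the same probability
    because a rotation-invariant law on the sphere determines it. *)

Require Import Defs.
From HB Require Import structures.
From mathcomp Require Import all_boot all_order all_algebra.
From mathcomp Require Import all_classical all_reals all_analysis.
From mathcomp Require Import measurable_realfun ring lra.
Set Implicit Arguments. Unset Strict Implicit. Unset Printing Implicit Defensive.
Import Order.TTheory GRing.Theory Num.Theory.
Import numFieldNormedType.Exports.
Local Open Scope classical_set_scope.
Local Open Scope ring_scope.

(** * Reflection of Lebesgue measure, incomplete beta integrals and the factor [mPU] *)

Lemma lebesgue_measure_onem (R : realType) (A : set R) : measurable A ->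
  pushforward (@lebesgue_measure R) (fun t => 1 - t : measurableTypeR R) A
  = lebesgue_measure A.
Proof.
have monem : measurable_fun setT (fun t : measurableTypeR R => 1 - t : measurableTypeR R).
  by exact: measurable_funB.
(* Half-open intervals determine the measure; reflection moves the closed end to the other side and
   keeps the length. *)
move=> mA; apply/esym/lebesgue_measure_unique => //= _ [[a b]] _ <-.
rewrite /pushforward/=.
have -> : (fun t : R => 1 - t) @^-1` `]a, b] = `[1 - b, 1 - a[%classic.
  by apply/seteqP; split=> t /=; rewrite !in_itv/= => /andP[? ?]; apply/andP; lra.
rewrite !lebesgue_measure_itv/= !lte_fin ltrD2l ltrN2.
by case: ifPn => // _; rewrite -!EFinD; congr _%:E; lra.
Qed.

(** Nonnegativity stands in for integrability, so the reflection applies to the beta integral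
    whether or not it converges. *)
Lemma ge0_integral_onem (R : realType) (D : set R) (f : R -> \bar R) :
  measurable D -> measurable_fun D f -> (forall t, 0 <= f t)%E ->
  (\int[@lebesgue_measure R]_(t in D) f t =
   \int[@lebesgue_measure R]_(t in (fun t : R => (1 - t)%R) @^-1` D) f (1 - t)%R)%E.
Proof.
move=> mD mf f0.
have monem : measurable_fun setT (fun t : measurableTypeR R => 1 - t : measurableTypeR R).
  by exact: measurable_funB.
rewrite -(@ge0_integral_pushforward _ _ _ _ _ _ monem _ D f)//.
by apply: eq_measure_integral => //= B mB _; exact/esym/lebesgue_measure_onem.
Qed.

(* A divergent beta integral takes the value [0] under [fine]; the first
   alternative absorbs that case, so that convergence never has to be proved. *)
Lemma betainc_upper_tail (R : realType) (a tau : R) : 1 / 2 <= tau < 1 ->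
  betaf a a = 0 /\ betainc a a tau = 0 \/
  0 < betaf a a - betainc a a tau <= betainc a a tau.
Proof.
move=> /andP[tau_ge tau_lt].
pose f (t : R) : R := t `^ (a - 1) * (1 - t) `^ (a - 1).
have f0 t : (0 <= (f t)%:E)%E by rewrite lee_fin mulr_ge0 // powR_ge0.
have fsym t : f (1 - t) = f t.
  by rewrite /f mulrC; congr (_ `^ _ * _ `^ _); lra.
have mf : measurable_fun setT f.
  apply: measurable_funM; first exact: measurable_powR.
  by apply: (measurableT_comp (measurable_powR _)); exact: measurable_funB.
have mfE (D : set R) : measurable_fun D (EFin \o f).
  by apply/measurable_EFinP; exact: measurable_funTS.
pose I (i : interval R) := (\int[@lebesgue_measure R]_(t in [set` i]) (f t)%:E)%E.
have I0 i : (0 <= I i)%E by apply: integral_ge0.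
have setE x : [set t : R | 0 <= t <= x] = `[0, x]%classic.
  by apply/seteqP; split=> t /=; rewrite in_itv.
have betaE x : betainc a a x = fine (I `[0, x]) by rewrite /betainc setE.
have Isplit : (I `[0%R, 1%R] = I `[0%R, tau] + I `]tau, 1%R])%E.
  rewrite /I -ge0_integral_setU//=.
  - by congr (integral _ _ _); rewrite -itv_bndbnd_setU// bnd_simp; lra.
  - exact: mfE.
  - rewrite disj_set2E; apply/eqP; rewrite -subset0 => t []/=.
    by rewrite !in_itv/= => /andP[_ ?] /andP[]; rewrite ltNge => /negP.
(* The reflection carries []tau, 1]] to [[0, 1 - tau[], which lies in [[0, tau]] because
   [tau >= 1/2], and the integrand is symmetric. *)
have Itail : (I `]tau, 1%R] <= I `[0%R, tau])%E.
  rewrite /I (@ge0_integral_onem _ _ _ (measurable_itv _) (mfE _) f0).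
  under eq_integral do rewrite /= fsym.
  apply: ge0_subset_integral => //=.
  - by rewrite -[X in measurable X]setTI; exact: measurable_funB.
  - exact: mfE.
  - by move=> t /=; rewrite !in_itv/= => /andP[? ?]; apply/andP; lra.
(* A zero integral would make [f] vanish almost everywhere on the tail, yet [f] is positive on
   []tau, 1[], which has positive length. The endpoint [1] is left out because [f] may vanish
   there. *)
have Igt0 : (0 < I `]tau, 1%R])%E.
  rewrite lt_neqAle I0 andbT; apply/negP => /eqP/esym I_eq0.
  have [M [mM M0 subM]] :
      ae_eq (@lebesgue_measure R) `]tau, 1%R]%classic (EFin \o f) (cst 0%E).
    apply/(ae_eq_integral_abs (@lebesgue_measure R)) => //; first exact: mfE.
    by rewrite -[RHS]I_eq0; apply: eq_integral => t _; rewrite gee0_abs ?f0.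
  have : (lebesgue_measure (`]tau, 1%R[%classic : set R) <= lebesgue_measure M)%E.
    apply: le_measure; rewrite ?inE// => t /=; rewrite in_itv/= => /andP[? ?].
    apply: subM => /=; apply/not_implyP; split.
      by rewrite in_itv/=; apply/andP; lra.
    by move=> -[] /eqP; apply/negP; rewrite gt_eqF// mulr_gt0 ?powR_gt0//; lra.
  by rewrite M0 lebesgue_measure_itv/= lte_fin tau_lt lee_fin; lra.
rewrite /betaf !betaE.
have [Ioo|Ifin] := eqVneq (I `[0%R, tau]) +oo%E.
  by left; rewrite Isplit Ioo addye// gt_eqF// (lt_trans _ Igt0).
right; have Ifin' : (I `[0%R, tau] \is a fin_num)%E.
  by rewrite ge0_fin_numE// lt_neqAle Ifin leey.
have Ifin2 : (I `]tau, 1%R] \is a fin_num)%E.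
  by rewrite ge0_fin_numE// (le_lt_trans Itail)// -ge0_fin_numE.
rewrite Isplit fineD// addrAC subrr add0r fine_gt0 ?Igt0 ?fine_le//.
by rewrite -ge0_fin_numE.
Qed.

(* [m(p)] is affine in [p], and the symmetry of the beta integral places its zero
   at or below [1/2]. *)
Lemma mPU_affine (R : realType) (d : nat) (gamma : R) :
  (2 <= d)%N -> 0 <= gamma -> gamma < 1 ->
  (forall p, mPU d gamma p = 0) \/
  exists K q : R, [/\ 0 < K, q <= 1 / 2 & forall p, mPU d gamma p = K * (p - q)].
Proof.
move=> d_ge2 g0 g1; rewrite /mPU /=.
set a := (d%:R - 1) / 2; set C := _ `^ a / _.
have C_gt0 : 0 < C.
  have d2 : 2 <= d%:R :> R by rewrite ler_nat.
  apply: divr_gt0; first by rewrite powR_gt0// subr_gt0 exprn_ilt1.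
  by apply: mulr_gt0; [exact: exprn_gt0 | lra].
have tau_bounds : 1 / 2 <= (1 + gamma) / 2 < 1 by apply/andP; lra.
have [[-> ->]|/andP[]] := betainc_upper_tail a tau_bounds.
  (* Both denominators of [m] are zero here, and the inverse of zero is zero. *)
  by left=> p; rewrite subr0 invr0 !mulr0 subr0 mulr0.
set B := betainc _ _ _; set A := _ - B => A_gt0 AB; right.
have B_gt0 : 0 < B by exact: lt_le_trans AB.
have AB_gt0 : 0 < A + B by exact: addr_gt0.
(* [q] is the zero of [p / A - (1 - p) / B]; it is at most [1/2] because [A <= B]. *)
exists (C * (A^-1 + B^-1)), (A / (A + B)); split.
- by rewrite mulr_gt0// addr_gt0// invr_gt0.
- by rewrite ler_pdivrMr//; lra.
- by move=> p; field; rewrite !gt_eqF.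
Qed.

(** Since [q <= 1/2], the allowed drop is at most the fraction [lambda / (1 + lambda)] of [p0 - q],
    which leaves [p - q >= (p0 - q) / (1 + lambda)]. Working with inverses also covers [m = 0]. *)
Lemma mPU_inv_le (R : realType) (d : nat) (gamma p0 p lambda : R) :
  (2 <= d)%N -> 0 <= gamma -> gamma < 1 -> 1 / 2 < p0 -> 0 < lambda ->
  p0 - lambda * (p0 - 1 / 2) / (1 + lambda) <= p ->
  [/\ 0 <= (mPU d gamma p0)^-1, 0 <= (mPU d gamma p)^-1 &
      (mPU d gamma p)^-1 <= (1 + lambda) * (mPU d gamma p0)^-1].
Proof.
move=> d_ge2 g0 g1 p0_gt l0 p_ge.
have [m0|[K [q [K_gt0 q_le mE]]]] := mPU_affine d_ge2 g0 g1.
  by rewrite !m0 invr0 mulr0.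
have l1 : 0 < 1 + lambda by lra.
have pq : (p0 - q) / (1 + lambda) <= p - q.
  rewrite ler_pdivrMr//.
  have : (p0 - lambda * (p0 - 1 / 2) / (1 + lambda)) * (1 + lambda) <= p * (1 + lambda).
    by rewrite ler_pM2r.
  rewrite mulrBl divfK ?gt_eqF// => H.
  have : 0 <= lambda * (1 / 2 - q) by apply: mulr_ge0; lra.
  by lra.
have p0q : 0 < p0 - q by lra.
have m0_gt0 : 0 < mPU d gamma p0 by rewrite mE mulr_gt0.
have m_ge : mPU d gamma p0 / (1 + lambda) <= mPU d gamma p.
  by rewrite !mE -mulrA ler_pM2l.
have m0l : 0 < mPU d gamma p0 / (1 + lambda) by exact: divr_gt0.
have m_gt0 : 0 < mPU d gamma p by exact: lt_le_trans m_ge.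
split; [by rewrite invr_ge0 ltW | by rewrite invr_ge0 ltW |].
by rewrite -invf_div lef_pV2 ?posrE.
Qed.

(** * Inner products and orthogonal maps on the unit sphere *)

Section SphereGeometry.
Context {R : realType} {d : nat}.
Implicit Types u v x y z : 'rV[R]_d.

Lemma dotvE u v : dotv u v = (u *m v^T) 0 0.
Proof. by rewrite mxE; apply: eq_bigr => i _; rewrite mxE. Qed.

Lemma dotvC u v : dotv u v = dotv v u.
Proof. by apply: eq_bigr => i _; rewrite mulrC. Qed.

Lemma dotv_mulmx u v (Q : 'M[R]_d) : dotv (u *m Q) v = dotv u (v *m Q^T).
Proof. by rewrite !dotvE trmx_mul trmxK mulmxA. Qed.

Lemma dotvNr u v : dotv u (- v) = - dotv u v.
Proof. by rewrite -sumrN; apply: eq_bigr => i _; rewrite mxE mulrN. Qed.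

Lemma dotvBl u v x : dotv (u - v) x = dotv u x - dotv v x.
Proof. by rewrite /dotv -sumrB; apply: eq_bigr => i _; rewrite !mxE mulrBl. Qed.

Lemma sqnormN u : sqnorm (- u) = sqnorm u.
Proof. by apply: eq_bigr => i _; rewrite !mxE mulrNN. Qed.

Lemma sqnorm_ge0 u : 0 <= sqnorm u.
Proof. by apply: sumr_ge0 => i _; rewrite -expr2 sqr_ge0. Qed.

Lemma sqnormZB (c : R) u v :
  sqnorm (c *: u - v) = c ^+ 2 * sqnorm u - 2 * c * dotv u v + sqnorm v.
Proof.
rewrite /sqnorm /dotv !mulr_sumr -sumrB -big_split/=.
by apply: eq_bigr => i _; rewrite !mxE; ring.
Qed.

Lemma sqnorm_eq0 u : sqnorm u = 0 -> u = 0.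
Proof.
move=> u0; apply/rowP => i; rewrite mxE; apply/eqP.
have H j : true -> 0 <= u 0 j * u 0 j by rewrite -expr2 sqr_ge0.
have /(_ i isT)/eqP := psumr_eq0P H u0.
by rewrite mulf_eq0 orbb.
Qed.

(** For unit vectors this is the nonnegativity of the squared norms of [u - v] and [u + v]. *)
Lemma dotv_le1 u v : sqnorm u = 1 -> sqnorm v = 1 -> `|dotv u v| <= 1.
Proof.
move=> u1 v1; rewrite ler_norml.
have := sqnorm_ge0 (1 *: u - v); have := sqnorm_ge0 ((-1) *: u - v).
by rewrite !sqnormZB u1 v1 => ? ?; apply/andP; split; lra.
Qed.

(* The witness is the Householder reflection exchanging [x] and [y]. *)
Lemma sphere_transitive x y : sqnorm x = 1 -> sqnorm y = 1 ->
  exists2 Q : 'M[R]_d, Q *m Q^T = 1%:M & x *m Q = y.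
Proof.
move=> x1 y1; have [->|neq] := eqVneq x y.
  by exists 1%:M; rewrite ?trmx1 mulmx1.
pose v := x - y; pose s := sqnorm v.
have s_neq0 : s != 0.
  by apply: contra neq => /eqP/sqnorm_eq0/eqP; rewrite subr_eq0.
have sE : s = 2 * (1 - dotv x y).
  by rewrite /s /v -[x]scale1r sqnormZB scale1r x1 y1; ring.
have vv : v *m v^T = s%:M.
  by apply/matrixP => i j; rewrite !ord1 -dotvE mxE eqxx.
(* As [<x, v> = s / 2], the reflection subtracts exactly [v] from [x], which leaves [y]. *)
have xv : x *m v^T = (s / 2)%:M.
  apply/matrixP => i j; rewrite !ord1 -dotvE mxE eqxx mulr1n dotvC dotvBl.
  by rewrite -/(sqnorm x) x1 sE dotvC; field.
pose H := 1%:M - (2 / s) *: (v^T *m v).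
have HT : H^T = H.
  by rewrite /H linearB/= linearZ/= trmx1 trmx_mul trmxK.
have vvv : v^T *m v *m (v^T *m v) = s *: (v^T *m v).
  by rewrite mulmxA -(mulmxA v^T) vv mul_mx_scalar scalemxAl.
exists H.
  rewrite HT /H mulmxBr mulmx1 mulmxBl mul1mx -scalemxAl -scalemxAr vvv !scalerA.
  rewrite (_ : 2 / s * (2 / s) * s = 2 / s + 2 / s); last by field.
  by rewrite scalerDl opprB addrK subrK.
rewrite /H mulmxBr mulmx1 -scalemxAr mulmxA xv mul_scalar_mx scalerA.
by rewrite (_ : 2 / s * (s / 2) = 1) ?scale1r ?subKr//; field.
Qed.

End SphereGeometry.

(** * Measurability and rotation-invariant laws on the sphere *)

Section RvMeasurable.
Context {R : realType} {d : nat} {dO : measure_display} {Omega : measurableType dO}.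

Lemma measurable_rv_continuous (Z : Omega -> 'rV[R]_d) (f : 'rV[R]_d -> R) :
  rv_measurable Z -> continuous f -> measurable_fun setT (f \o Z).
Proof.
move=> mZ /continuousP cf; apply: (measurability _ (RGenOpens.measurableE R)).
move=> _ [_ [a [b ->] <-]]; rewrite setTI comp_preimage; apply: mZ.
by apply: sub_sigma_algebra; apply/cf/interval_open.
Qed.

Lemma measurable_rv_coord (Z : Omega -> 'rV[R]_d) (i : 'I_d) :
  rv_measurable Z -> measurable_fun setT (fun w => Z w 0 i).
Proof.
move=> mZ; apply: (measurable_rv_continuous mZ (f := fun u => u 0 i)).
exact: coord_continuous.
Qed.

Lemma measurable_rv_dotv (Z : Omega -> 'rV[R]_d) (x : 'rV[R]_d) :
  rv_measurable Z -> measurable_fun setT (fun w => dotv (Z w) x).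
Proof.
move=> mZ; apply: measurable_sum => i; apply: measurable_funM => //.
exact: measurable_rv_coord.
Qed.

Lemma measurable_rv_sqnorm (Z : Omega -> 'rV[R]_d) :
  rv_measurable Z -> measurable_fun setT (fun w => sqnorm (Z w)).
Proof.
move=> mZ; apply: measurable_sum => i.
by apply: measurable_funM; exact: measurable_rv_coord.
Qed.

Lemma continuous_dotv (x : 'rV[R]_d) : continuous (fun z : 'rV[R]_d => dotv z x).
Proof.
apply: continuous_big => [|i _ z]; first exact: add_continuous.
by apply: continuousM; [exact: coord_continuous|exact: cst_continuous].
Qed.

Lemma borelRd_Cap (gamma : R) (x : 'rV[R]_d) : borelRd (Cap gamma x).
Proof.
have -> : Cap gamma x = ~` ((fun z => dotv z x) @^-1` [set t | t < gamma]).
  by apply/seteqP; split=> z /=; rewrite /Cap/= leNgt => /negP.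
apply: sigma_algebraC; apply: sub_sigma_algebra.
by have /continuousP := @continuous_dotv x; apply; exact: open_lt.
Qed.

Lemma measurable_in_Cap (Z : Omega -> 'rV[R]_d) (gamma : R) (x : 'rV[R]_d) :
  rv_measurable Z -> measurable_fun setT (fun w => gamma <= dotv (Z w) x).
Proof.
by move=> mZ; apply: measurable_fun_ler => //; exact: measurable_rv_dotv.
Qed.

Lemma unif_sphere_ae (P : probability Omega R) (Z : Omega -> 'rV[R]_d) :
  unif_sphere P Z -> {ae P, forall w, sqnorm (Z w) = 1}.
Proof.
move=> [mZ Z1 _].
have mS : measurable (Z @^-1` @Ssphere R d).
  by have := measurable_rv_sqnorm mZ measurableT (measurable_set1 1); rewrite setTI.
exists (~` (Z @^-1` @Ssphere R d)); split => //; first exact: measurableC.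
by rewrite probability_setC// Z1 subee.
Qed.

(** An orthogonal map taking [y] to [x] pulls the cap of [x] back to the cap of [y] and preserves
    the law of [Z]. *)
Lemma Cap_probability_const (P : probability Omega R) (Z : Omega -> 'rV[R]_d)
    (gamma : R) (x y : 'rV[R]_d) :
  unif_sphere P Z -> sqnorm x = 1 -> sqnorm y = 1 ->
  P (Z @^-1` Cap gamma x) = P (Z @^-1` Cap gamma y).
Proof.
move=> [_ _ Zrot] x1 y1; have [Q QQ yQ] := sphere_transitive y1 x1.
rewrite (Zrot Q QQ _ (borelRd_Cap _ _)); congr (P _).
apply/seteqP; split=> w; rewrite /Cap/= dotv_mulmx -yQ -mulmxA QQ mulmx1 //.
Qed.

End RvMeasurable.

(* Integrating the indicator of [gamma <= <U, Z>] in either order shows that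
   the caps have the same probability under any two rotation-invariant laws. *)
Lemma Cap_probability_unique (R : realType) (d : nat)
    (d1 d2 : measure_display) (O1 : measurableType d1) (O2 : measurableType d2)
    (P1 : probability O1 R) (P2 : probability O2 R)
    (U : O1 -> 'rV[R]_d) (Z : O2 -> 'rV[R]_d) (gamma : R) (x : 'rV[R]_d) :
  unif_sphere P1 U -> unif_sphere P2 Z -> sqnorm x = 1 ->
  P1 (U @^-1` Cap gamma x) = P2 (Z @^-1` Cap gamma x).
Proof.
move=> unifU unifZ x1; have [mU _ _] := unifU; have [mZ _ _] := unifZ.
pose A : set (O1 * O2) := [set w | gamma <= dotv (U w.1) (Z w.2)].
have mA : measurable A.
  rewrite -[A]setTI.
  have : measurable_fun setT (fun w : O1 * O2 => gamma <= dotv (U w.1) (Z w.2)).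
    apply: measurable_fun_ler => //; apply: measurable_sum => i.
    apply: measurable_funM.
      by apply: (measurableT_comp (measurable_rv_coord i mU)).
    by apply: (measurableT_comp (measurable_rv_coord i mZ)).
  by move=> /(_ measurableT [set true] I).
pose f (w : O1 * O2) : \bar R := (\1_A w)%:E.
have mf : measurable_fun setT f by apply/measurable_EFinP/measurable_indic.
have f0 w : (0 <= f w)%E by rewrite lee_fin.
have mcap d' (O' : measurableType d') (V : O' -> 'rV[R]_d) y :
    rv_measurable V -> measurable (V @^-1` Cap gamma y).
  by move=> mV; apply: mV; exact: borelRd_Cap.
(* For almost every [w] the point [U w] is a unit vector, so the inner integral is the probability
   of a cap centred at [U w], whatever that centre is. *)
have inner2 : (\int[P1]_w \int[P2]_v f (w, v) = P2 (Z @^-1` Cap gamma x))%E.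
  transitivity (\int[P1]_w cst (P2 (Z @^-1` Cap gamma x)) w)%E; last first.
    by rewrite integral_cst//= probability_setT mule1.
  apply: ae_eq_integral => //; first exact: measurable_fun_fubini_tonelli_F.
  apply: filterS (unif_sphere_ae unifU) => w Uw1 _ /=.
  rewrite -(Cap_probability_const gamma unifZ Uw1 x1) -[in RHS](setIT (_ @^-1` _)).
  rewrite -integral_indic//; last exact: mcap.
  apply: eq_integral => v _; rewrite /f !indicE.
  suff -> : ((w, v) \in A) = (v \in Z @^-1` Cap gamma (U w)) by [].
  by apply/idP/idP; rewrite !inE /A /Cap/= dotvC.
have inner1 : (\int[P2]_v \int[P1]_w f (w, v) = P1 (U @^-1` Cap gamma x))%E.
  transitivity (\int[P2]_w cst (P1 (U @^-1` Cap gamma x)) w)%E; last first.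
    by rewrite integral_cst//= probability_setT mule1.
  apply: ae_eq_integral => //; first exact: measurable_fun_fubini_tonelli_G.
  apply: filterS (unif_sphere_ae unifZ) => v Zv1 _ /=.
  rewrite -(Cap_probability_const gamma unifU Zv1 x1) -[in RHS](setIT (_ @^-1` _)).
  by rewrite -integral_indic//; exact: mcap.
by rewrite -inner1 -inner2 fubini_tonelli.
Qed.

(** * Second moments of sums of indicators *)

Section BernoulliVariance.
Context {R : realType} {dO : measure_display} {Omega : measurableType dO}
  (P : probability Omega R).

Lemma bounded_integrable (f : Omega -> R) (M : R) : measurable_fun setT f ->
  (forall w, `|f w| <= M) -> P.-integrable setT (EFin \o f).
Proof.
move=> mf fM; apply: measurable_bounded_integrable => //.
  by rewrite /= probability_setT ltry.
exists M; split; first exact: num_real.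
by move=> y My w _; exact: le_trans (fM w) (ltW My).
Qed.

Lemma Rintegral_sum (I : Type) (s : seq I) (f : I -> Omega -> R) :
  (forall i, P.-integrable setT (EFin \o f i)) ->
  \int[P]_w (\sum_(i <- s) f i w) = \sum_(i <- s) \int[P]_w f i w.
Proof.
move=> intf; rewrite /Rintegral.
under eq_integral do rewrite -sumEFin.
rewrite (integral_sum measurableT (f := fun i => EFin \o f i))//.
by rewrite -sum_fine// => i _; exact: integrable_fin_num.
Qed.

Lemma Rintegral_indic (A : set Omega) : measurable A ->
  \int[P]_w \1_A w = Prob P A.
Proof. by move=> mA; rewrite /Rintegral integral_indic// setIT. Qed.

(** One covariance formula serves both kinds of terms of a squared sum: [A = B] gives [p (1 - p)],
    independent events give [0]. *)
Lemma Rintegral_centered_indicM (A B : set Omega) (p q : R) :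
  measurable A -> measurable B -> Prob P A = p -> Prob P B = q ->
  \int[P]_w ((\1_A w - p) * (\1_B w - q)) = Prob P (A `&` B) - p * q.
Proof.
move=> mA mB Ap Bq.
have int_indic C : measurable C -> P.-integrable setT (EFin \o (\1_C : Omega -> R)).
  by move=> mC; exact: integrable_indic.
have int_cst (c : R) : P.-integrable setT (EFin \o (fun=> c)).
  exact: finite_measure_integrable_cst.
have intZ (c : R) C : measurable C ->
    P.-integrable setT (EFin \o (fun w => c * \1_C w)).
  by move=> mC; have := integrableZl measurableT c (int_indic C mC).
transitivity (\int[P]_w (\1_(A `&` B) w + ((- q) * \1_A w + ((- p) * \1_B w + p * q)))).
  by congr (Rintegral _ _ _); apply/funext => w; rewrite indicI/=; ring.
have intBc : P.-integrable setT (EFin \o (fun w => (- p) * \1_B w + p * q)).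
  by have := integrableD measurableT (intZ (- p) B mB) (int_cst (p * q)).
have intABc : P.-integrable setT
    (EFin \o (fun w => (- q) * \1_A w + ((- p) * \1_B w + p * q))).
  by have := integrableD measurableT (intZ (- q) A mA) intBc.
rewrite RintegralD//; last exact/int_indic/measurableI.
rewrite RintegralD//; last exact: intZ.
rewrite RintegralD//; last exact: intZ.
rewrite !RintegralZl//; [|exact: int_indic..].
rewrite !Rintegral_indic//; last exact: measurableI.
by rewrite Rintegral_cst//= Ap Bq probability_setT/=; ring.
Qed.

(** Expanding the square, pairwise independence kills the off-diagonal terms and leaves [N] equal
    variances. *)
Lemma Rintegral_sum_indic_sqr (N : nat) (A : 'I_N -> set Omega) (p : R) :
  (forall k, measurable (A k)) -> (forall k, Prob P (A k) = p) ->
  (forall j k, j != k -> Prob P (A j `&` A k) = p ^+ 2) ->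
  \int[P]_w (\sum_(k < N) (\1_(A k) w - p)) ^+ 2 = N%:R * (p * (1 - p)).
Proof.
move=> mA Ap Aind.
have mc k : measurable_fun setT (fun w => \1_(A k) w - p : R).
  by apply: measurable_funB.
have cle k w : `|\1_(A k) w - p| <= 1 + `|p|.
  rewrite (le_trans (ler_normB _ _))// lerD2r indicE.
  by case: (_ \in _); rewrite ?normr0 ?normr1.
have intjk j k : P.-integrable setT
    (EFin \o (fun w => (\1_(A j) w - p) * (\1_(A k) w - p))).
  apply: (@bounded_integrable _ ((1 + `|p|) ^+ 2)); first exact: measurable_funM.
  by move=> w; rewrite normrM expr2; apply: ler_pM.
transitivity (\int[P]_w (\sum_(j < N) \sum_(k < N) (\1_(A j) w - p) * (\1_(A k) w - p))).
  congr (Rintegral _ _ _); apply/funext => w; rewrite expr2 mulr_suml.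
  by apply: eq_bigr => j _; rewrite mulr_sumr.
rewrite Rintegral_sum; last first.
  move=> j.
  rewrite (_ : _ \o _ = fun w =>
    (\sum_(k < N) ((\1_(A j) w - p) * (\1_(A k) w - p))%:E)%E).
    by apply: integrable_sum => // k _; exact: intjk.
  by apply/funext => w /=; rewrite sumEFin.
under eq_bigr => j _.
  rewrite Rintegral_sum// (bigD1 j)//= big1 => [|k kj]; last first.
    by rewrite (Rintegral_centered_indicM (mA _) (mA _) (Ap _) (Ap _)) Aind 1?eq_sym//
      expr2 subrr.
  rewrite (Rintegral_centered_indicM (mA _) (mA _) (Ap _) (Ap _)) setIid Ap addr0.
  over.
by rewrite sumr_const card_ord -mulr_natl; ring.
Qed.

End BernoulliVariance.

(** * The MMRC weights for fixed candidates *)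

Lemma sum_if_count (R : realType) (N : nat) (inc : pred 'I_N) (u v : R) :
  \sum_(k < N) (if inc k then u else v) =
  (\sum_(k < N) (if inc k then 1 else 0)) * u
  + (N%:R - \sum_(k < N) (if inc k then 1 else 0)) * v.
Proof.
have -> : (N%:R : R) = \sum_(k < N) 1 by rewrite sumr_const card_ord.
rewrite -sumrB !mulr_suml -big_split/=; apply: eq_bigr => k _.
by case: ifP => _; ring.
Qed.

Lemma sum_indicator_bounds (R : realType) (N : nat) (inc : pred 'I_N) :
  0 <= \sum_(k < N) (if inc k then 1 else 0 : R) <= N%:R.
Proof.
have -> : (N%:R : R) = \sum_(k < N) 1 by rewrite sumr_const card_ord.
by rewrite sumr_ge0 ?ler_sum// => k _; case: ifP.
Qed.

Section Densities.
Context {R : realType} (p0 thb : R).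

Lemma c1_ge0 : 0 <= p0 <= 1 -> 0 < thb < 1 -> 0 <= c1 p0 thb.
Proof. by move=> ? ?; rewrite /c1 divr_ge0//; lra. Qed.

Lemma c2_ge0 : 0 <= p0 <= 1 -> 0 < thb < 1 -> 0 <= c2 p0 thb.
Proof. by move=> ? ?; rewrite /c2 divr_ge0//; lra. Qed.

Lemma thetabar_c1 : 0 < thb < 1 -> thb * c1 p0 thb = p0.
Proof. by move=> ?; rewrite /c1 mulrC divfK// gt_eqF//; lra. Qed.

Lemma thetabar_c2 : 0 < thb < 1 -> (1 - thb) * c2 p0 thb = 1 - p0.
Proof. by move=> ?; rewrite /c2 mulrC divfK// gt_eqF//; lra. Qed.

End Densities.

Section PiMmrc.
Context {R : realType} {d N : nat} (gamma p0 thb : R) (x : 'rV[R]_d)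
  (zs : 'I_N -> 'rV[R]_d).

Local Notation pi := (pi_mmrc gamma p0 thb x zs).
Local Notation inc k := (gamma <= dotv (zs k) x).
Local Notation a := (c1 p0 thb).
Local Notation b := (c2 p0 thb).
Local Notation theta := ((\sum_(k < N) (if inc k then 1 else 0)) / N%:R : R).

(* Both weights agree with the unclipped ones at [theta = thb], so the three
   cases of [pi_mmrc] reduce to two for each kind of candidate. *)
Lemma pi_mmrcE k : (0 < N)%N -> 0 < thb < 1 -> pi k =
  if inc k then
    (if theta <= thb then a / N%:R else (1 - (1 - theta) * b) / (N%:R * theta))
  else
    (if theta < thb then (1 - theta * a) / (N%:R * (1 - theta)) else b / N%:R).
Proof.
move=> N_gt0 t01.
have mixture : thb * a + (1 - thb) * b = 1.
  by rewrite thetabar_c1// thetabar_c2//; ring.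
have N_neq0 : N%:R != 0 :> R by rewrite pnatr_eq0 -lt0n.
rewrite /pi_mmrc mixture; set th := theta; rewrite !divr1 !mul1r.
have [lt|gt|->] := ltrgtP th thb.
- case: ifP => _; first by rewrite mulrC.
  by congr (_ / _); congr (_ - _); field.
- case: ifP => _; last by rewrite mulrC.
  by congr (_ / _); congr (_ - _); field.
- by rewrite mixture; case: ifP => _; rewrite divr1 mulrC.
Qed.

Lemma theta_bounds : (0 < N)%N -> 0 <= theta <= 1.
Proof.
move=> N_gt0.
have /andP[c_ge0 c_le] := @sum_indicator_bounds R N (fun k => inc k).
by rewrite divr_ge0 ?ler_pdivrMr ?mul1r ?ltr0n.
Qed.

(** The [N * theta] cap candidates share one weight. Division by [theta] occurs only when
    [theta > thb > 0], so it cancels. *)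
Lemma pi_mmrc_cap_sum : (0 < N)%N -> 0 < thb < 1 ->
  \sum_(k < N) pi k * (if inc k then 1 else 0) =
  if theta <= thb then theta * a else 1 - (1 - theta) * b.
Proof.
move=> N_gt0 t01.
have N_neq0 : N%:R != 0 :> R by rewrite pnatr_eq0 -lt0n.
have piE k : pi k * (if inc k then 1 else 0) = if inc k then
    (if theta <= thb then a / N%:R else (1 - (1 - theta) * b) / (N%:R * theta))
    else 0.
  by rewrite pi_mmrcE//; case: (inc k); rewrite ?mulr1 ?mulr0.
under eq_bigr do rewrite piE.
rewrite sum_if_count mulr0 addr0.
move: (theta_bounds N_gt0); set c := \sum_(k < N) _.
have : c = N%:R * (c / N%:R) by rewrite mulrCA divff// mulr1.
set th := c / N%:R => -> th01.
case: ifPn => [_|]; first by field.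
rewrite -ltNge => ?.
by rewrite mulrCA divff ?mulr1// mulf_neq0// gt_eqF//; lra.
Qed.

(** Mirror image of the cap sum: division by [1 - theta] occurs only when [theta < thb < 1]. *)
Lemma pi_mmrc_off_sum : (0 < N)%N -> 0 < thb < 1 ->
  \sum_(k < N) pi k * (if inc k then 0 else 1) =
  if theta < thb then 1 - theta * a else (1 - theta) * b.
Proof.
move=> N_gt0 t01.
have N_neq0 : N%:R != 0 :> R by rewrite pnatr_eq0 -lt0n.
have piE k : pi k * (if inc k then 0 else 1) = if inc k then 0 else
    (if theta < thb then (1 - theta * a) / (N%:R * (1 - theta)) else b / N%:R).
  by rewrite pi_mmrcE//; case: (inc k); rewrite ?mulr1 ?mulr0.
under eq_bigr do rewrite piE.
rewrite sum_if_count mulr0 add0r.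
move: (theta_bounds N_gt0); set c := \sum_(k < N) _.
have : c = N%:R * (c / N%:R) by rewrite mulrCA divff// mulr1.
set th := c / N%:R => -> th01.
rewrite -[X in X - N%:R * th](mulr1 N%:R) -mulrBr.
case: ifPn => [?|_]; last by field.
by rewrite mulrCA divff ?mulr1// mulf_neq0// gt_eqF//; lra.
Qed.

(** Away from [theta = thb] the cap and off-cap masses are complementary by construction; at
    equality they are [p0] and [1 - p0]. *)
Lemma pi_mmrc_sum : (0 < N)%N -> 0 < thb < 1 ->
  \sum_(k < N) pi k = 1.
Proof.
move=> N_gt0 t01.
transitivity (\sum_(k < N) (pi k * (if inc k then 1 else 0)
                          + pi k * (if inc k then 0 else 1))).
  by apply: eq_bigr => k _; case: ifP => _; ring.
rewrite big_split/= pi_mmrc_cap_sum// pi_mmrc_off_sum//.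
have := thetabar_c1 p0 t01; have := thetabar_c2 p0 t01; set th := theta.
by have [lt|gt|->] := ltrgtP th thb; lra.
Qed.

(** The rebalanced numerators stay nonnegative: [1 - (1 - theta) c2 >= p0] when [theta > thb], and
    [1 - theta c1 >= 1 - p0] when [theta < thb]. *)
Lemma pi_mmrc_ge0 k : (0 < N)%N -> 0 <= p0 <= 1 -> 0 < thb < 1 ->
  0 <= pi k.
Proof.
move=> N_gt0 p01 t01.
have a0 := c1_ge0 p01 t01; have b0 := c2_ge0 p01 t01.
have pa := @thetabar_c1 _ p0 _ t01; have pb := @thetabar_c2 _ p0 _ t01.
have N0 : 0 <= N%:R :> R by exact: ler0n.
rewrite pi_mmrcE//; move: (theta_bounds N_gt0).
set th := theta => /andP[th0 th1]; clearbody th.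
case: ifP => _; [case: (leP th thb) | case: (ltP th thb)] => H.
- exact: divr_ge0.
- apply: divr_ge0; last exact: mulr_ge0.
  have : 0 <= (th - thb) * b by apply: mulr_ge0 => //; lra.
  by lra.
- apply: divr_ge0; last by apply: mulr_ge0 => //; lra.
  have : 0 <= (thb - th) * a by apply: mulr_ge0 => //; lra.
  by lra.
- exact: divr_ge0.
Qed.

(* Only a deficit of cap candidates lowers the cap probability, by
   [a * (thb - theta)]; AM-GM makes that loss quadratic. *)
Lemma pi_mmrc_cap_sum_ge (D : R) : (0 < N)%N -> 0 <= p0 <= 1 -> 0 < thb < 1 ->
  0 < D ->
  p0 - D / 2 - (a * (theta - thb)) ^+ 2 / (2 * D) <=
  \sum_(k < N) pi k * (if inc k then 1 else 0).
Proof.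
move=> N_gt0 p01 t01 D_gt0; have a0 := c1_ge0 p01 t01; have b0 := c2_ge0 p01 t01.
have pa := @thetabar_c1 _ p0 _ t01; have pb := @thetabar_c2 _ p0 _ t01.
rewrite pi_mmrc_cap_sum//; set th := theta; clearbody th.
have [y yE] : exists y, y = a * (th - thb) by eexists.
rewrite -yE.
have amgm : - y <= D / 2 + y ^+ 2 / (2 * D).
  (* The gap in AM-GM is an explicit square. *)
  have -> : D / 2 + y ^+ 2 / (2 * D) = - y + (y + D) ^+ 2 / (2 * D).
    by field; rewrite gt_eqF.
  by rewrite lerDl divr_ge0 ?sqr_ge0//; lra.
have sq0 : 0 <= y ^+ 2 / (2 * D) by rewrite divr_ge0 ?sqr_ge0//; lra.
(* With an excess of cap candidates the cap probability is [p0 + (theta - thb) c2], hence at least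
   [p0]. *)
case: ifPn => [_|]; last first.
  rewrite -ltNge => ?; have : 0 <= (th - thb) * b by rewrite mulr_ge0//; lra.
  by move: sq0; set z := y ^+ 2 / (2 * D); lra.
have -> : th * a = p0 + y by lra.
by move: amgm; set z := y ^+ 2 / (2 * D); lra.
Qed.

End PiMmrc.

(** * Numerical consequences of privacy and of the sample size *)

Lemma ln_ge_half (R : realType) (y : R) : 2 <= y -> 1 / 2 <= ln y.
Proof.
move=> y_ge2; rewrite -ler_expR lnK ?posrE; last by lra.
(* [exp (1/2) <= 2], because [exp (-1/2) >= 1 - 1/2]. *)
apply: le_trans y_ge2; have := expR_ge1Dx (- (1 / 2) : R); rewrite expRN.
have e_gt0 := expR_gt0 (1 / 2 : R).
have half_gt0 : 0 < 1 / 2 :> R by lra.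
rewrite (_ : 1 + - (1 / 2) = (2 : R)^-1); last by field.
by rewrite lef_pV2 ?posrE.
Qed.

(** The average [thb c1 + (1 - thb) c2] is [1], so [c1] and [c2] cannot both exceed [1]. If
    [c2 <= 1] then [c1 <= e c2 <= e]; otherwise [c1 <= 1], and the two ratio bounds together force
    [e >= 1]. *)
Lemma c1_le_ratio (R : realType) (p0 thb e : R) :
  0 < p0 <= 1 -> 0 < thb < 1 ->
  c1 p0 thb <= e * c2 p0 thb -> c2 p0 thb <= e * c1 p0 thb ->
  c1 p0 thb <= e.
Proof.
move=> p01 t01; have p01' : 0 <= p0 <= 1 by apply/andP; lra.
have a_gt0 : 0 < c1 p0 thb by rewrite /c1 divr_gt0//; lra.
have b_ge0 := c2_ge0 p01' t01.
have pa := thetabar_c1 p0 t01; have pb := thetabar_c2 p0 t01.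
move: (c1 p0 thb) (c2 p0 thb) a_gt0 b_ge0 pa pb => a b a_gt0 b_ge0 pa pb ab ba.
have e_gt0 : 0 < e.
  rewrite ltNge; apply/negP => e_le0.
  have : e * b <= 0 by nra.
  by lra.
have e_ge1 : 1 <= e.
  rewrite leNgt; apply/negP => e_lt1.
  have : e * b <= b by nra.
  have : e * a < a by nra.
  by lra.
have [b_le1|b_gt1] := leP b 1; first by nra.
suff : a <= 1 by lra.
by rewrite leNgt; apply/negP => a_gt1; nra.
Qed.

(** With [D = lambda (p0 - 1/2) / (1 + lambda)] the hypothesis reads [n >= exp (2 eps) / 2 * (2 /
    D)^2 * ln (4 / D)]. As [D <= 1/2], the logarithm is at least [1/2], which gives
    [n >= exp (2 eps) / D^2]. *)
Lemma sample_size_bound (R : realType) (eps p0 lambda n : R) :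
  1 / 2 < p0 -> p0 <= 1 -> 0 < lambda ->
  expR (2 * eps) / 2 * (2 * (1 + lambda) / (lambda * (p0 - 1 / 2))) ^+ 2
    * ln (4 * (1 + lambda) / (lambda * (p0 - 1 / 2))) <= n ->
  expR eps ^+ 2 <= n * (lambda * (p0 - 1 / 2) / (1 + lambda)) ^+ 2.
Proof.
move=> p0_gt p0_le l0.
have [D DE] : exists D, D = lambda * (p0 - 1 / 2) / (1 + lambda) by eexists.
have lp_gt0 : 0 < lambda * (p0 - 1 / 2) by rewrite mulr_gt0// subr_gt0.
have l1 : 0 < 1 + lambda by lra.
have D_gt0 : 0 < D by rewrite DE divr_gt0.
have D_le : D <= 1 / 2.
  rewrite DE ler_pdivrMr//.
  have : lambda * (p0 - 1 / 2) <= lambda * (1 / 2) by rewrite ler_pM2l//; lra.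
  by lra.
rewrite -DE.
have nz : lambda * (p0 - 1 / 2) != 0 by rewrite gt_eqF.
have divE c : c * (1 + lambda) / (lambda * (p0 - 1 / 2)) = c / D.
  by rewrite DE invf_div mulrA.
rewrite !divE -expRM_natl.
have ln_ge : 1 / 2 <= ln (4 / D) by apply: ln_ge_half; rewrite ler_pdivlMr//; lra.
have e_gt0 := expR_gt0 (2 * eps).
move: (expR _) (ln _) ln_ge e_gt0 => e l l_ge e_gt0 n_ge.
have D2_gt0 : 0 < D ^+ 2 by rewrite exprn_gt0.
apply: (le_trans _ (ler_wpM2r (ltW D2_gt0) n_ge)).
have -> : e / 2 * (2 / D) ^+ 2 * l * D ^+ 2 = e * (2 * l) by field; rewrite gt_eqF.
by apply: ler_peMr; [exact: ltW|lra].
Qed.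

(** * The expected cap probability of MMRC *)

Section Mmrc.
Context {R : realType} {d N : nat} {dO : measure_display}
  {Omega : measurableType dO} (P : probability Omega R)
  (Z : 'I_N -> Omega -> 'rV[R]_d) (gamma p0 thb : R) (x : 'rV[R]_d).

Local Notation inc k w := (gamma <= dotv (Z k w) x).
Local Notation pi w := (pi_mmrc gamma p0 thb x (fun k => Z k w)).

Lemma measurable_pi_mmrc k : (forall j, rv_measurable (Z j)) ->
  measurable_fun setT (fun w => pi w k).
Proof.
move=> mZ.
have minc j := measurable_in_Cap gamma x (mZ j).
have mif j (u v : Omega -> R) : measurable_fun setT u -> measurable_fun setT v ->
    measurable_fun setT (fun w => if inc j w then u w else v w).
  by move=> mu mv; exact: measurable_fun_ifT.
have mth : measurable_fun setT
    (fun w => (\sum_(j < N) (if inc j w then 1 else 0)) / N%:R : R).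
  by apply: measurable_funM => //; apply: measurable_sum => j; exact: mif.
(* The inverse of [u] is [u] times the real power [-1] of [u^2]; at [u = 0] both sides are zero. *)
have mV (u : Omega -> R) : measurable_fun setT u ->
    measurable_fun setT (fun w => (u w)^-1).
  move=> mu; rewrite (_ : (fun w => _) = fun w => u w * (u w ^+ 2) `^ (-1)).
    apply: measurable_funM => //; apply: (measurableT_comp (measurable_powR _)).
    exact: measurable_funX.
  apply/funext => w; rewrite powR_inv1 ?sqr_ge0//.
  have [->|u0] := eqVneq (u w) 0; first by rewrite invr0 mul0r.
  by field.
rewrite /pi_mmrc /=.
apply: measurable_fun_ifT; first exact: measurable_fun_eqr.
  apply: measurable_funM => //; apply: measurable_funM; first exact: mif.
  apply: mV; apply: measurable_funD; apply: measurable_funM => //.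
  exact: measurable_funB.
apply: measurable_fun_ifT; first exact: measurable_fun_ltr.
  apply: mif => //; apply: measurable_funM.
    apply: measurable_funB => //; apply: measurable_funM => //.
    exact: measurable_funM.
  by apply: mV; apply: measurable_funM => //; exact: measurable_funB.
apply: mif => //; apply: measurable_funM.
  apply: measurable_funB => //; apply: measurable_funM => //.
  by apply: measurable_funM => //; exact: measurable_funB.
by apply: mV; exact: measurable_funM.
Qed.

End Mmrc.

(** Mutual independence is applied with the whole space at every index other than [j] and [k]. *)
Lemma mutually_indep_pair (R : realType) (d N : nat) (dO : measure_display)
    (Omega : measurableType dO) (P : probability Omega R)
    (Z : 'I_N -> Omega -> 'rV[R]_d) (A : set 'rV[R]_d) (j k : 'I_N) :
  mutually_indep P Z -> borelRd A -> j != k ->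
  Prob P (Z j @^-1` A `&` Z k @^-1` A) =
  Prob P (Z j @^-1` A) * Prob P (Z k @^-1` A).
Proof.
move=> indep bA jk.
have bT : borelRd [set: 'rV[R]_d] by apply: sub_sigma_algebra; exact: openT.
pose B (i : 'I_N) := if (i == j) || (i == k) then A else setT.
have /indep : forall i, borelRd (B i) by move=> i; rewrite /B; case: ifP.
rewrite (_ : [set w | _] = Z j @^-1` A `&` Z k @^-1` A); last first.
  apply/seteqP; split=> [w Bw | w [Aj Ak] i] /=.
    by split; [have := Bw j | have := Bw k]; rewrite /B eqxx ?orbT.
  by rewrite /B; case: ifPn => // /orP[]/eqP ->.
move=> ->; rewrite (bigD1 j)//= (bigD1 k) 1?eq_sym//= big1 ?mulr1.
  by rewrite /B !eqxx orbT.
move=> i /andP[/negbTE ij /negbTE ik]; rewrite /B ij ik/= preimage_setT.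
by rewrite /Prob probability_setT.
Qed.

(** Integrating the pointwise bound loses [D / 2] from its constant term and, by the variance
    hypothesis, at most [D / 2] from its quadratic term. *)
Lemma p_mmrc_ge (R : realType) (d N : nat) (dO : measure_display)
    (Omega : measurableType dO) (P : probability Omega R)
    (Z : 'I_N -> Omega -> 'rV[R]_d) (gamma p0 thb D : R) (x : 'rV[R]_d) :
  (0 < N)%N -> 0 <= p0 <= 1 -> 0 < thb < 1 -> 0 < D ->
  (forall k, rv_measurable (Z k)) -> mutually_indep P Z ->
  (forall k, Prob P (Z k @^-1` Cap gamma x) = thb) ->
  c1 p0 thb ^+ 2 * (thb * (1 - thb)) <= N%:R * D ^+ 2 ->
  p0 - D <= \int[P]_w (\sum_(k < N) pi_mmrc gamma p0 thb x (fun j => Z j w) k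
                        * (if gamma <= dotv (Z k w) x then 1 else 0)).
Proof.
move=> N_gt0 p01 t01 D_gt0 mZ indep Zthb Dvar.
pose A k := Z k @^-1` Cap gamma x.
have mA k : measurable (A k) by apply: mZ; exact: borelRd_Cap.
have incE k w : (if gamma <= dotv (Z k w) x then 1 else 0) = \1_(A k) w :> R.
  rewrite indicE /A /Cap; case: ifPn => H; first by rewrite mem_set.
  by rewrite memNset//=; exact/negP.
pose S w : R := \sum_(k < N) (\1_(A k) w - thb).
have N_gt0' : 0 < N%:R :> R by rewrite ltr0n.
have N_neq0 : N%:R != 0 :> R by rewrite gt_eqF.
(* As [S = N (theta - thb)], this makes [c S^2] the quadratic loss
   [(c1 (theta - thb))^2 / (2 D)]. *)
pose c : R := c1 p0 thb ^+ 2 / (N%:R ^+ 2 * (2 * D)).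
have varS : \int[P]_w S w ^+ 2 = N%:R * (thb * (1 - thb)).
  apply: Rintegral_sum_indic_sqr => // j k jk; rewrite /A mutually_indep_pair//.
    by rewrite !Zthb expr2.
  exact: borelRd_Cap.
have mS : measurable_fun setT S.
  by apply: measurable_sum => k; exact: measurable_funB.
have S_le w : `|S w| <= N%:R * (1 + `|thb|).
  apply: le_trans (ler_norm_sum _ _ _) _.
  have -> : N%:R * (1 + `|thb|) = \sum_(k < N) (1 + `|thb|).
    by rewrite sumr_const card_ord mulr_natl.
  apply: ler_sum => k _; rewrite (le_trans (ler_normB _ _))// lerD2r indicE.
  by case: (_ \in _); rewrite ?normr0 ?normr1.
have intS2 : P.-integrable setT (EFin \o (fun w => S w ^+ 2)).
  apply: (@bounded_integrable _ _ _ _ _ ((N%:R * (1 + `|thb|)) ^+ 2)).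
    exact: measurable_funX.
  by move=> w; rewrite normrX lerXn2r ?nnegrE// (le_trans _ (S_le w)).
have intcS2 : P.-integrable setT (EFin \o (fun w => c * S w ^+ 2)).
  by have := integrableZl measurableT c intS2.
have intcst : P.-integrable setT (EFin \o (fun=> p0 - D / 2)).
  exact: finite_measure_integrable_cst.
have intlow : P.-integrable setT (EFin \o (fun w => p0 - D / 2 - c * S w ^+ 2)).
  by have := integrableB measurableT intcst intcS2.
pose h w : R := \sum_(k < N) pi_mmrc gamma p0 thb x (fun j => Z j w) k
                        * (if gamma <= dotv (Z k w) x then 1 else 0).
have mh : measurable_fun setT h.
  apply: measurable_sum => k; apply: measurable_funM.
    exact: measurable_pi_mmrc.
  by apply: measurable_fun_ifT => //; exact: measurable_in_Cap.
have h_le w : `|h w| <= 1.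
  rewrite ger0_norm; last first.
    apply: sumr_ge0 => k _; apply: mulr_ge0; first exact: pi_mmrc_ge0.
    by case: ifP.
  rewrite -(pi_mmrc_sum gamma p0 x (fun j => Z j w) N_gt0 t01).
  apply: ler_sum => k _; rewrite ler_piMr ?pi_mmrc_ge0//.
  by case: ifP.
have inth : P.-integrable setT (EFin \o h) by exact: bounded_integrable h_le.
have low w : p0 - D / 2 - c * S w ^+ 2 <= h w.
  apply: le_trans (pi_mmrc_cap_sum_ge gamma x (fun j => Z j w) N_gt0 p01 t01 D_gt0).
  rewrite lerD2l lerN2 le_eqVlt; apply/orP; left; apply/eqP.
  have -> : (\sum_(k < N) (if gamma <= dotv (Z k w) x then 1 else 0)) / N%:R - thb
            = S w / N%:R.
    rewrite /S; under eq_bigr do rewrite incE.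
    rewrite sumrB sumr_const card_ord -mulr_natl; field.
    exact: N_neq0.
  by rewrite /c; field; rewrite N_neq0 gt_eqF.
apply: le_trans (le_Rintegral measurableT intlow inth (fun w _ => low w)).
rewrite RintegralB// RintegralZl// varS Rintegral_cst//= probability_setT/= mulr1.
suff : c * (N%:R * (thb * (1 - thb))) <= D / 2 by lra.
have -> : c * (N%:R * (thb * (1 - thb))) =
    c1 p0 thb ^+ 2 * (thb * (1 - thb)) / (N%:R * (2 * D)).
  by rewrite /c; field; rewrite N_neq0 gt_eqF.
rewrite ler_pdivrMr; last by apply: mulr_gt0 => //; lra.
by apply: le_trans Dvar _; rewrite le_eqVlt; apply/orP; left; apply/eqP; field.
Qed.

(** * The risk of PrivUnit2 *)

Lemma measurable_rv_sqnormZB (R : realType) (d : nat) (dO : measure_display)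
    (Omega : measurableType dO) (V : Omega -> 'rV[R]_d) (c : R) (x : 'rV[R]_d) :
  rv_measurable V -> measurable_fun setT (fun w => sqnorm (c *: V w - x)).
Proof.
move=> mV; under eq_fun do rewrite sqnormZB.
apply: measurable_funD => //; apply: measurable_funB; apply: measurable_funM => //.
  exact: measurable_rv_sqnorm.
exact: measurable_rv_dotv.
Qed.

Section PrivUnitRisk.
Context {R : realType} {d : nat} {dO : measure_display}
  {Omega : measurableType dO} (P : probability Omega R)
  (U : Omega -> 'rV[R]_d) (gamma p0 : R) (x : 'rV[R]_d).

Local Notation thb := (thetabar P U gamma x).

(** The density has total mass [thb c1 + (1 - thb) c2 = 1]; the factor [c] turns constant bounds on
    the loss into integrals against it. *)
Lemma integral_pu_density (c : R) : rv_measurable U -> 0 < thb < 1 ->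
  (\int[P]_w (c * pu_density gamma p0 thb x (U w))%:E = c%:E)%E.
Proof.
move=> mU t01.
have mA : measurable (U @^-1` Cap gamma x) by apply: mU; exact: borelRd_Cap.
pose a := c1 p0 thb; pose b := c2 p0 thb; pose A := U @^-1` Cap gamma x.
have dE w : c * pu_density gamma p0 thb x (U w) = c * (a - b) * \1_A w + c * b.
  rewrite /pu_density indicE /A /Cap; case: ifPn => H.
    by rewrite mem_set//= mulr1 -/a; ring.
  by rewrite memNset/=; [rewrite mulr0 add0r | exact/negP].
under eq_integral do rewrite dE EFinD EFinM.
have intA : P.-integrable setT (EFin \o (\1_A : Omega -> R)).
  exact: integrable_indic.
have intZA : P.-integrable setT (fun w => (c * (a - b))%:E * (\1_A w)%:E)%E.
  exact: integrableZl.
have intb : P.-integrable setT (EFin \o (fun=> c * b)).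
  exact: finite_measure_integrable_cst.
rewrite integralD// integralZl// integral_indic// setIT integral_cst//=.
rewrite probability_setT mule1.
have -> : P A = thb%:E by rewrite /thetabar /Prob fineK// fin_num_measure.
rewrite -EFinM -EFinD; congr (_%:E).
transitivity (c * (thb * a + (1 - thb) * b)); first by ring.
by rewrite thetabar_c1// thetabar_c2//; ring.
Qed.

(** Almost surely [c U] has norm [c], hence lies at distance at least [|c - 1|] from the unit vector
    [x]. *)
Lemma pu_risk_ge (c : R) : unif_sphere P U -> sqnorm x = 1 ->
  0 <= p0 <= 1 -> 0 < thb < 1 -> 0 <= c ->
  (c - 1) ^+ 2 <= fine (\int[P]_w
    (sqnorm (c *: U w - x) * pu_density gamma p0 thb x (U w))%:E)%E.
Proof.
move=> unifU x1 p01 t01 c0; have [mU _ _] := unifU.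
pose dens w := pu_density gamma p0 thb x (U w).
have dens0 w : 0 <= dens w.
  by rewrite /dens /pu_density; case: ifP => _; [exact: c1_ge0 | exact: c2_ge0].
have mdens : measurable_fun setT dens.
  by apply: measurable_fun_ifT => //; exact: measurable_in_Cap.
have mg : measurable_fun setT (fun w => sqnorm (c *: U w - x) * dens w).
  by apply: measurable_funM => //; exact: measurable_rv_sqnormZB.
have mk (k : R) : measurable_fun setT (fun w => (k * dens w)%:E).
  by apply/measurable_EFinP; exact: measurable_funM.
have bounds : {ae P, forall w, (c - 1) ^+ 2 <= sqnorm (c *: U w - x) <= (c + 1) ^+ 2}.
  apply: filterS (unif_sphere_ae unifU) => w Uw1.
  have := dotv_le1 Uw1 x1; rewrite ler_norml sqnormZB Uw1 x1 => /andP[lo hi].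
  by apply/andP; split; nra.
have lo : (((c - 1) ^+ 2)%:E <=
    \int[P]_w (sqnorm (c *: U w - x) * dens w)%:E)%E.
  rewrite -(integral_pu_density ((c - 1) ^+ 2) mU t01).
  apply: ae_ge0_le_integral => //.
  - by move=> w _; rewrite lee_fin mulr_ge0 ?sqr_ge0//; exact: dens0.
  - by move=> w _; rewrite lee_fin mulr_ge0 ?sqnorm_ge0.
  - exact/measurable_EFinP.
  - apply: filterS bounds => w /andP[? _] _.
    by rewrite lee_fin; apply: ler_wpM2r => //; exact: dens0.
(* [fine] sends [+oo] to [0], so the lower bound passes through it only once the risk is known to be
   finite. *)
have hi : (\int[P]_w (sqnorm (c *: U w - x) * dens w)%:E
    <= ((c + 1) ^+ 2)%:E)%E.
  rewrite -(integral_pu_density ((c + 1) ^+ 2) mU t01).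
  apply: ae_ge0_le_integral => //.
  - by move=> w _; rewrite lee_fin mulr_ge0 ?sqnorm_ge0.
  - exact/measurable_EFinP.
  - by move=> w _; rewrite lee_fin mulr_ge0 ?sqr_ge0//; exact: dens0.
  - apply: filterS bounds => w /andP[_ ?] _.
    by rewrite lee_fin; apply: ler_wpM2r => //; exact: dens0.
rewrite -lee_fin fineK// ge0_fin_numE; first exact: le_lt_trans hi (ltry _).
by apply: le_trans lo; rewrite lee_fin sqr_ge0.
Qed.

End PrivUnitRisk.

(** * Comparison of the two risks *)

Theorem theorem6 (R : realType) (d N : nat) (eps p0 gamma lambda : R)
  (dO : measure_display) (Omega : measurableType dO) (P : probability Omega R)
  (U : Omega -> 'rV[R]_d) (Z : 'I_N -> Omega -> 'rV[R]_d) :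
  (2 <= d)%N ->
  0 <= gamma -> gamma < 1 ->
  1 / 2 < p0 -> p0 <= 1 ->
  (* U ~ Unif(S^{d-1}) (reference measure); Z_1..Z_N i.i.d. Unif(S^{d-1}) *)
  unif_sphere P U ->
  (forall k, unif_sphere P (Z k)) ->
  mutually_indep P Z ->
  (* PrivUnit2 with parameters p0, gamma is eps-LDP *)
  (forall x x' z : 'rV[R]_d, sqnorm x = 1 -> sqnorm x' = 1 -> sqnorm z = 1 ->
     pu_density gamma p0 (thetabar P U gamma x) x z <=
     expR eps * pu_density gamma p0 (thetabar P U gamma x') x' z) ->
  0 < lambda ->
  expR (2 * eps) / 2 * (2 * (1 + lambda) / (lambda * (p0 - 1 / 2))) ^+ 2
    * ln (4 * (1 + lambda) / (lambda * (p0 - 1 / 2))) <= N%:R ->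
  forall x : 'rV[R]_d, sqnorm x = 1 ->
  let thb := thetabar P U gamma x in
  let m_pu := mPU d gamma p0 in
  let E := fine (\int[P]_w
             (sqnorm (m_pu^-1 *: U w - x) * pu_density gamma p0 thb x (U w))%:E) in
  let pi := fun w => pi_mmrc gamma p0 thb x (fun k => Z k w) in
  let p_mmrc := fine (\int[P]_w
             (\sum_(k < N) pi w k * (if gamma <= dotv (Z k w) x then 1 else 0))%:E) in
  let m_mmrc := mPU d gamma p_mmrc in
  (\int[P]_w (\sum_(k < N) pi w k * sqnorm (m_mmrc^-1 *: Z k w - x))%:E
    <= ((1 + lambda) ^+ 2 * E + 2 * (1 + lambda) * (2 + lambda) * Num.sqrt E
        + (2 + lambda) ^+ 2)%:E)%E.
Proof.
move=> d_ge2 g0 g1 p0_gt p0_le unifU unifZ indep ldp l0 N_ge x x1 /=.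
set thb := thetabar P U gamma x; set m := mPU d gamma p0.
set pm := fine _; set E := fine _.
have mZ k : rv_measurable (Z k) by have [] := unifZ k.
have Zthb k : Prob P (Z k @^-1` Cap gamma x) = thb.
  by rewrite /Prob -(Cap_probability_unique gamma unifU (unifZ k) x1).
have p01 : 0 <= p0 <= 1 by apply/andP; lra.
have mU : rv_measurable U by have [] := unifU.
have thb_ge0 : 0 <= thb by rewrite /thb /thetabar /Prob fine_ge0.
have thb_le1 : thb <= 1.
  rewrite -lee_fin fineK ?fin_num_measure//; last by apply: mU; exact: borelRd_Cap.
  by apply: probability_le1; apply: mU; exact: borelRd_Cap.
have E_ge0 : 0 <= E.
  apply: fine_ge0; apply: integral_ge0 => w _; rewrite lee_fin mulr_ge0 ?sqnorm_ge0//.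
  by rewrite /pu_density /c1 /c2; case: ifP => _; rewrite divr_ge0//; lra.
(* Privacy is tested at the inputs [x] and [- x] with output [x]: since [0 <= gamma < 1], that
   output lies in the cap of [x] and outside the cap of [- x]. *)
have [c12 c21] : c1 p0 thb <= expR eps * c2 p0 thb /\
    c2 p0 thb <= expR eps * c1 p0 thb.
  have xN1 : sqnorm (- x) = 1 by rewrite sqnormN.
  have thbN : thetabar P U gamma (- x) = thb.
    by rewrite /thb /thetabar /Prob (Cap_probability_const gamma unifU xN1 x1).
  have xx : dotv x x = 1 by exact: x1.
  have := ldp x (- x) x x1 xN1 x1; have := ldp (- x) x x xN1 x1 x1.
  have g_leN1 : (gamma <= -1) = false by apply/negbTE; rewrite -ltNge; lra.
  by rewrite thbN /pu_density -/thb dotvNr xx (ltW g1) g_leN1.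
have e_gt0 := expR_gt0 eps.
have l1 : 0 < 1 + lambda by lra.
have [D DE] : exists D, D = lambda * (p0 - 1 / 2) / (1 + lambda) by eexists.
have D_gt0 : 0 < D by rewrite DE divr_gt0 ?mulr_gt0//; lra.
have N_D : expR eps ^+ 2 <= N%:R * D ^+ 2 by rewrite DE; exact: sample_size_bound.
have N_gt0 : (0 < N)%N.
  rewrite lt0n; apply/eqP => N0; move: N_D; rewrite N0 mul0r leNgt => /negP; apply.
  by rewrite exprn_gt0.
have rhs_ge0 : 0 <= (1 + lambda) ^+ 2 * E + 2 * (1 + lambda) * (2 + lambda) * Num.sqrt E
    + (2 + lambda) ^+ 2.
  have s0 := sqrtr_ge0 E.
  by rewrite !addr_ge0 ?mulr_ge0 ?sqr_ge0//; lra.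
(* If [thb = 1] then [c2 = (1 - p0) / 0 = 0], which contradicts local privacy. *)
have thb_lt1 : thb < 1.
  rewrite lt_neqAle thb_le1 andbT; apply/eqP => thb1; move: c12.
  by rewrite thb1 /c1 /c2 subrr invr0 !mulr0 divr1; lra.
have mrisk c : measurable_fun setT (fun w => (\sum_(k < N)
    pi_mmrc gamma p0 thb x (fun j => Z j w) k * sqnorm (c *: Z k w - x))%:E).
  apply/measurable_EFinP; apply: measurable_sum => k; apply: measurable_funM.
    exact: measurable_pi_mmrc.
  exact: measurable_rv_sqnormZB.
(* If [thb = 0] then [c1 = p0 / 0 = 0], local privacy forces [c2 = 0], and all the
   MMRC weights vanish almost surely. *)
have [thb0|thb_neq0] := eqVneq thb 0.
  have c1_0 : c1 p0 thb = 0 by rewrite thb0 /c1 invr0 mulr0.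
  have c2_0 : c2 p0 thb = 0.
    by move: c21; rewrite c1_0 thb0 /c2 subr0 divr1 mulr0; lra.
  have Zout : {ae P, forall w, forall k, ~~ (gamma <= dotv (Z k w) x)}.
    apply: filter_forall => k; exists (Z k @^-1` Cap gamma x).
    have mA : measurable (Z k @^-1` Cap gamma x) by apply: mZ; exact: borelRd_Cap.
    split=> //; last by move=> w /= /negP; rewrite negbK.
    by rewrite -[LHS]fineK ?fin_num_measure// -/(Prob P _) Zthb thb0.
  rewrite (ae_eq_integral (cst 0%E))//; first by rewrite integral0 lee_fin.
  (* No candidate is in the cap, so [theta = 0 = thb] and the unclipped branch, with zero
     numerators, applies. *)
  apply: filterS Zout => w out _ /=; congr (_%:E); apply: big1 => k _.
  rewrite /pi_mmrc c1_0 c2_0 big1 => [|j _]; last by rewrite (negbTE (out j)).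
  by rewrite mul0r thb0 eqxx if_same !mul0r mulr0 mul0r.
have t01 : 0 < thb < 1 by rewrite thb_lt1 andbT lt_neqAle eq_sym thb_neq0.
have c1_le : c1 p0 thb <= expR eps.
  by apply: (c1_le_ratio _ t01 c12 c21); apply/andP; lra.
(* The variance condition follows from [c1^2 thb (1 - thb) <= c1^2 <= exp (eps)^2 <= N D^2]. *)
have pm_ge : p0 - D <= pm.
  apply: p_mmrc_ge => //; apply: le_trans N_D.
  have c1_0 := c1_ge0 p01 t01.
  apply: (@le_trans _ _ (c1 p0 thb ^+ 2)).
    by apply: ler_piMr; [exact: sqr_ge0 | nra].
  by rewrite lerXn2r// nnegrE ltW.
have [m_ge0 mm_ge0 mm_le] : [/\ 0 <= m^-1, 0 <= (mPU d gamma pm)^-1 &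
    (mPU d gamma pm)^-1 <= (1 + lambda) * m^-1].
  by apply: mPU_inv_le => //; rewrite -DE.
have m_le : m^-1 <= 1 + Num.sqrt E.
  have E_ge := pu_risk_ge unifU x1 p01 t01 m_ge0.
  rewrite -lerBlDl; apply: le_trans (ler_norm _) _.
  by rewrite -sqrtr_sqr; exact: ler_wsqrtr.
move: ((mPU d gamma pm)^-1) mm_ge0 mm_le => c c0 c_le.
have c_le' : c + 1 <= (1 + lambda) * Num.sqrt E + (2 + lambda).
  have : (1 + lambda) * m^-1 <= (1 + lambda) * (1 + Num.sqrt E) by rewrite ler_pM2l.
  by lra.
(* The target is the square of [(1 + lambda) sqrt E + (2 + lambda)], which dominates [c + 1]. *)
apply: (@le_trans _ _ ((c + 1) ^+ 2)%:E); last first.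
  rewrite lee_fin -{1}(sqr_sqrtr E_ge0).
  have -> : (1 + lambda) ^+ 2 * Num.sqrt E ^+ 2
     + 2 * (1 + lambda) * (2 + lambda) * Num.sqrt E + (2 + lambda) ^+ 2
     = ((1 + lambda) * Num.sqrt E + (2 + lambda)) ^+ 2 by ring.
  by rewrite lerXn2r// nnegrE; lra.
have -> : ((c + 1) ^+ 2)%:E = (\int[P]_w (cst ((c + 1) ^+ 2)%:E) w)%E.
  by rewrite integral_cst//= probability_setT mule1.
have sum_ge0 w : 0 <= \sum_(k < N) pi_mmrc gamma p0 thb x (fun j => Z j w) k
    * sqnorm (c *: Z k w - x).
  by apply: sumr_ge0 => k _; rewrite mulr_ge0 ?pi_mmrc_ge0 ?sqnorm_ge0.
apply: ae_ge0_le_integral => //.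
- by move=> w _; rewrite lee_fin; exact: sum_ge0.
- by move=> w _; rewrite lee_fin sqr_ge0.
(* Almost surely all candidates are unit vectors, so every loss is at most [(c + 1)^2]; the weights
   sum to one and preserve this bound. *)
have Z1 : {ae P, forall w, forall k, sqnorm (Z k w) = 1}.
  by apply: filter_forall => k; exact: unif_sphere_ae.
apply: filterS Z1 => w Zw1 _; rewrite lee_fin.
have -> : (c + 1) ^+ 2 = \sum_(k < N)
    pi_mmrc gamma p0 thb x (fun j => Z j w) k * (c + 1) ^+ 2.
  by rewrite -mulr_suml pi_mmrc_sum// mul1r.
apply: ler_sum => k _; apply: ler_wpM2l; first exact: pi_mmrc_ge0.
have := dotv_le1 (Zw1 k) x1; rewrite ler_norml sqnormZB Zw1 x1 => /andP[lo hi].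
have : 0 <= c * (dotv (Z k w) x + 1) by apply: mulr_ge0 => //; lra.
by lra.
Qed.
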